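(* Let $(\mathcal D,\otimes,I)$ be a symmetric monoidal closed category and $\mathcal E$ a class of epimorphisms of $\mathcal D$ containing all isomorphisms and closed under composition. Suppose that $\mathcal D$ is stable with respect to $\mathcal E$, that $\mathcal E$ is closed under wide pushouts, and that $\mathcal E$ is closed under tensor products. Then the forgetful functor from the category $\mathrm{Mon}(\mathcal D)$ of monoids in $\mathcal D$ to $\mathcal D$ creates wide pushouts of $\mathcal E$-carried morphisms: given a family of monoid morphisms $e_i:(D,\mu,\eta)\to(D_i,\mu_i,\eta_i)$ ($i\in I$) whose underlying morphisms lie in $\mathcal E$, and a wide pushout $\overline{e_i}:D_i\to\overline D$ ($i\in I$) of the $e_i$ in $\mathcal D$, there is a unique monoid structure on $\overline D$ making all $\overline{e_i}$ monoid morphisms, and with this structure the $\overline{e_i}$ form a wide pushout of the $e_i$ in $\mathrm{Mon}(\mathcal D)$.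
   Context: A monoid in $\mathcal D$ is an object $M$ with morphisms $m:M\otimes M\to M$, $i:I\to M$ satisfying associativity and unit laws; monoid morphisms preserve $m$ and $i$. $\mathcal D$ is stable w.r.t. $\mathcal E$ if for all $a:A\to A'$ and $b:B\to B'$ in $\mathcal E$ the square formed by $a\otimes B$, $A\otimes b$, $A'\otimes b$, $a\otimes B'$ (with diagonal $a\otimes b:A\otimes B\to A'\otimes B'$) is a pushout. $\mathcal E$ is closed under wide pushouts if for every family of $\mathcal E$-morphisms with common domain, the morphisms of its wide pushout (when it exists) lie in $\mathcal E$. $\mathcal E$ is closed under tensor products if $a,b\in\mathcal E$ implies $a\otimes b\in\mathcal E$. *)

(* Defs.v *)
From Stdlib Require Import ProofIrrelevance.

Set Implicit Arguments.
Unset Strict Implicit.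
Unset Printing Implicit Defensive.

Declare Scope cat_scope.
Delimit Scope cat_scope with cat.
Open Scope cat_scope.

Record category : Type := Category {
  obj :> Type;
  hom : obj -> obj -> Type;
  idm : forall A, hom A A;
  comp : forall A B C, hom B C -> hom A B -> hom A C;
  comp_idl : forall A B (f : hom A B), comp (idm B) f = f;
  comp_idr : forall A B (f : hom A B), comp f (idm A) = f;
  comp_assoc : forall A B C D (h : hom C D) (g : hom B C) (f : hom A B),
    comp h (comp g f) = comp (comp h g) f
}.

Arguments hom {c} A B.
Arguments idm {c} A.
Arguments comp {c A B C} g f.

Notation "g ∘ f" := (comp g f) (at level 40, left associativity) : cat_scope.

Definition is_iso (C : category) (A B : C) (f : hom A B) : Prop :=
  exists g : hom B A, g ∘ f = idm A /\ f ∘ g = idm B.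

Definition is_epi (C : category) (A B : C) (f : hom A B) : Prop :=
  forall (X : C) (g h : hom B X), g ∘ f = h ∘ f -> g = h.

Definition morphism_class (C : category) : Type :=
  forall A B : C, hom A B -> Prop.

Definition is_pushout (C : category) (A B B' P : C)
    (f : hom A B) (g : hom A B') (p : hom B P) (q : hom B' P) : Prop :=
  p ∘ f = q ∘ g /\
  forall (X : C) (u : hom B X) (v : hom B' X), u ∘ f = v ∘ g ->
    exists! t : hom P X, t ∘ p = u /\ t ∘ q = v.

(* A wide pushout of a family [e] is a colimit of the diagram formed by all
   the [e j].  A cocone of this diagram consists of the legs [ebar j] and of
   the component [d] at the common domain.  If [J] is inhabited, [d] is
   determined by the legs; it matters only for the empty family, of which
   [D] itself (and not an initial object) is the wide pushout. *)
Definition is_wide_pushout (C : category) (J : Type) (D : C) (Dj : J -> C)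
    (e : forall j, hom D (Dj j)) (P : C)
    (d : hom D P) (ebar : forall j, hom (Dj j) P) : Prop :=
  (forall j, ebar j ∘ e j = d) /\
  forall (X : C) (u : hom D X) (v : forall j, hom (Dj j) X),
    (forall j, v j ∘ e j = u) ->
    exists! t : hom P X, t ∘ d = u /\ forall j, t ∘ ebar j = v j.

Record monoidal_category : Type := MonoidalCategory {
  mcat :> category;
  tensor : mcat -> mcat -> mcat;
  tensor_hom : forall A A' B B' : mcat,
    hom A A' -> hom B B' -> hom (tensor A B) (tensor A' B');
  unit_obj : mcat;
  assoc : forall A B C : mcat,
    hom (tensor (tensor A B) C) (tensor A (tensor B C));
  lunit : forall A : mcat, hom (tensor unit_obj A) A;
  runit : forall A : mcat, hom (tensor A unit_obj) A;
  tensor_idm : forall A B : mcat,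
    tensor_hom (idm A) (idm B) = idm (tensor A B);
  tensor_comp : forall (A A' A'' B B' B'' : mcat)
      (f' : hom A' A'') (f : hom A A') (g' : hom B' B'') (g : hom B B'),
    tensor_hom (f' ∘ f) (g' ∘ g) = tensor_hom f' g' ∘ tensor_hom f g;
  assoc_iso : forall A B C : mcat, is_iso (assoc A B C);
  lunit_iso : forall A : mcat, is_iso (lunit A);
  runit_iso : forall A : mcat, is_iso (runit A);
  assoc_natural : forall (A A' B B' C C' : mcat)
      (f : hom A A') (g : hom B B') (h : hom C C'),
    assoc A' B' C' ∘ tensor_hom (tensor_hom f g) h =
    tensor_hom f (tensor_hom g h) ∘ assoc A B C;
  lunit_natural : forall (A A' : mcat) (f : hom A A'),
    lunit A' ∘ tensor_hom (idm unit_obj) f = f ∘ lunit A;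
  runit_natural : forall (A A' : mcat) (f : hom A A'),
    runit A' ∘ tensor_hom f (idm unit_obj) = f ∘ runit A;
  pentagon : forall A B C D : mcat,
    assoc A B (tensor C D) ∘ assoc (tensor A B) C D =
    tensor_hom (idm A) (assoc B C D) ∘ assoc A (tensor B C) D
      ∘ tensor_hom (assoc A B C) (idm D);
  triangle : forall A B : mcat,
    tensor_hom (idm A) (lunit B) ∘ assoc A unit_obj B =
    tensor_hom (runit A) (idm B)
}.

Arguments tensor {m} A B.
Arguments tensor_hom {m A A' B B'} f g.
Arguments unit_obj {m}.
Arguments assoc {m} A B C.
Arguments lunit {m} A.
Arguments runit {m} A.

Notation "A ⊗ B" := (tensor A B)
  (at level 35, right associativity) : cat_scope.
Notation "f ⊠ g" := (tensor_hom f g)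
  (at level 35, right associativity) : cat_scope.

Record symmetric_monoidal_category : Type := SymmetricMonoidalCategory {
  smcat :> monoidal_category;
  sym : forall A B : smcat, hom (A ⊗ B) (B ⊗ A);
  sym_natural : forall (A A' B B' : smcat) (f : hom A A') (g : hom B B'),
    sym A' B' ∘ (f ⊠ g) = (g ⊠ f) ∘ sym A B;
  sym_invol : forall A B : smcat, sym B A ∘ sym A B = idm (A ⊗ B);
  hexagon : forall A B C : smcat,
    assoc B C A ∘ sym A (B ⊗ C) ∘ assoc A B C =
    (idm B ⊠ sym A C) ∘ assoc B A C ∘ (sym A B ⊠ idm C)
}.

(* Closedness: each functor [- ⊗ A] has a right adjoint [ihom A -], presented
   by its counit [ev]. *)
Record symmetric_monoidal_closed_category : Type :=
  SymmetricMonoidalClosedCategory {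
  smccat :> symmetric_monoidal_category;
  ihom : smccat -> smccat -> smccat;
  ev : forall A B : smccat, hom (ihom A B ⊗ A) B;
  ev_universal : forall (A B X : smccat) (f : hom (X ⊗ A) B),
    exists! g : hom X (ihom A B), ev A B ∘ (g ⊠ idm A) = f
}.

Record monoid_structure (V : monoidal_category) (M : V) : Type :=
  MonoidStructure {
  mul : hom (M ⊗ M) M;
  one : hom unit_obj M;
  mul_assoc : mul ∘ (mul ⊠ idm M) = mul ∘ (idm M ⊠ mul) ∘ assoc M M M;
  mul_onel : mul ∘ (one ⊠ idm M) = lunit M;
  mul_oner : mul ∘ (idm M ⊠ one) = runit M
}.

Definition is_monoid_morphism (V : monoidal_category) (M N : V)
    (S : monoid_structure M) (T : monoid_structure N) (f : hom M N) : Prop :=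
  f ∘ mul S = mul T ∘ (f ⊠ f) /\ f ∘ one S = one T.

Record monoid (V : monoidal_category) : Type := Monoid {
  carrier :> V;
  structure : monoid_structure carrier
}.

Arguments structure {V} m.

Record monoid_morphism (V : monoidal_category) (M N : monoid V) : Type :=
  MonoidMorphism {
  underlying :> hom (carrier M) (carrier N);
  underlyingP : is_monoid_morphism (structure M) (structure N) underlying
}.

Lemma monoid_morphism_eq (V : monoidal_category) (M N : monoid V)
    (f g : monoid_morphism M N) : underlying f = underlying g -> f = g.
Proof.
destruct f as [f hf]; destruct g as [g hg]; simpl; intros <-.
now rewrite (proof_irrelevance _ hf hg).
Qed.

Lemma is_monoid_morphism_idm (V : monoidal_category) (M : V)
    (S : monoid_structure M) : is_monoid_morphism S S (idm M).
Proof. split; now rewrite ?tensor_idm, ?comp_idl, ?comp_idr. Qed.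

Lemma is_monoid_morphism_comp (V : monoidal_category) (M N P : V)
    (S : monoid_structure M) (T : monoid_structure N) (U : monoid_structure P)
    (g : hom N P) (f : hom M N) :
  is_monoid_morphism T U g -> is_monoid_morphism S T f ->
  is_monoid_morphism S U (g ∘ f).
Proof.
intros [gm g1] [fm f1]; split.
- now rewrite <- comp_assoc, fm, comp_assoc, gm, tensor_comp, comp_assoc.
- now rewrite <- comp_assoc, f1.
Qed.

Definition monoid_idm (V : monoidal_category) (M : monoid V) :
    monoid_morphism M M :=
  MonoidMorphism (is_monoid_morphism_idm (structure M)).

Definition monoid_comp (V : monoidal_category) (M N P : monoid V)
    (g : monoid_morphism N P) (f : monoid_morphism M N) :
    monoid_morphism M P :=
  MonoidMorphism (is_monoid_morphism_comp (underlyingP g) (underlyingP f)).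

Definition Mon (V : monoidal_category) : category.
Proof.
refine (@Category (monoid V) (@monoid_morphism V) (@monoid_idm V)
  (@monoid_comp V) _ _ _); intros; apply monoid_morphism_eq; simpl.
- apply comp_idl.
- apply comp_idr.
- apply comp_assoc.
Defined.

Section Classes.

Variables (V : monoidal_category) (E : morphism_class V).

Definition consists_of_epis : Prop :=
  forall (A B : V) (f : hom A B), E f -> is_epi f.

Definition contains_isos : Prop :=
  forall (A B : V) (f : hom A B), is_iso f -> E f.

Definition closed_under_composition : Prop :=
  forall (A B C : V) (g : hom B C) (f : hom A B), E g -> E f -> E (g ∘ f).

Definition closed_under_tensor : Prop :=
  forall (A A' B B' : V) (a : hom A A') (b : hom B B'),
    E a -> E b -> E (a ⊠ b).

(* The component [d] at the common domain then also lies in [E] as soon as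
   [E] contains isomorphisms and is closed under composition. *)
Definition closed_under_wide_pushouts : Prop :=
  forall (J : Type) (D : V) (Dj : J -> V) (e : forall j, hom D (Dj j))
    (P : V) (d : hom D P) (ebar : forall j, hom (Dj j) P),
    (forall j, E (e j)) -> is_wide_pushout e d ebar -> forall j, E (ebar j).

Definition stable_wrt : Prop :=
  forall (A A' B B' : V) (a : hom A A') (b : hom B B'), E a -> E b ->
    is_pushout (a ⊠ idm B) (idm A ⊠ b) (idm A' ⊠ b) (a ⊠ idm B').

End Classes.

(* Main.v *)
From Stdlib Require Import Classical ClassicalEpsilon ProofIrrelevance.
Require Import Defs.

Set Implicit Arguments.
Unset Strict Implicit.
Unset Printing Implicit Defensive.

(** The heart of the matter is that the [ebar j ⊠ ebar j] form a wide pushout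
    of the [e j ⊠ e j].  Since the tensor preserves colimits in each variable,
    a cocone [v j] on the [e j ⊠ e j] with apex [X] induces, after
    precomposition with [id ⊠ e j] and with [e j ⊠ id], morphisms
    [Dbar ⊗ D -> X] and [D ⊗ Dbar -> X].  They agree on [D ⊗ D], so by
    stability they glue to a morphism [Dbar ⊗ Dbar -> X].  Applied to the cocone
    of the [ebar j ∘ mul], this yields the multiplication of [Dbar]; its unit is
    the image of that of [D].  All equations can be checked after precomposition
    with tensor products of [d : D -> Dbar] and identities, which are
    epimorphisms because [d] lies in [E] (for an empty family [d] is an
    isomorphism). *)

(** * Calculus of tensor products of morphisms *)

Lemma tensor_comp_idl (V : monoidal_category) (A A' A'' B : V)
    (f' : hom A' A'') (f : hom A A') :
  (f' ∘ f) ⊠ idm B = (f' ⊠ idm B) ∘ (f ⊠ idm B).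
Proof. now rewrite <- tensor_comp, comp_idl. Qed.

Lemma tensor_comp_idr (V : monoidal_category) (A B B' B'' : V)
    (g' : hom B' B'') (g : hom B B') :
  idm A ⊠ (g' ∘ g) = (idm A ⊠ g') ∘ (idm A ⊠ g).
Proof. now rewrite <- tensor_comp, comp_idl. Qed.

Lemma tensor_split_idr (V : monoidal_category) (A A' B B' : V)
    (f : hom A A') (g : hom B B') :
  f ⊠ g = (f ⊠ idm B') ∘ (idm A ⊠ g).
Proof. now rewrite <- tensor_comp, comp_idl, comp_idr. Qed.

Lemma tensor_split_idl (V : monoidal_category) (A A' B B' : V)
    (f : hom A A') (g : hom B B') :
  f ⊠ g = (idm A' ⊠ g) ∘ (f ⊠ idm B).
Proof. now rewrite <- tensor_comp, comp_idl, comp_idr. Qed.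

Lemma monoid_structure_eq (V : monoidal_category) (M : V)
    (S T : monoid_structure M) : mul S = mul T -> one S = one T -> S = T.
Proof.
destruct S as [m i a l r]; destruct T as [m' i' a' l' r']; simpl.
intros <- <-; f_equal; apply proof_irrelevance.
Qed.

(** * Currying, and preservation of wide pushouts by tensoring *)

Definition curry (V : symmetric_monoidal_closed_category) (A B X : V)
    (f : hom (X ⊗ A) B) : hom X (ihom A B) :=
  proj1_sig (constructive_indefinite_description _ (ev_universal f)).

Lemma curryP (V : symmetric_monoidal_closed_category) (A B X : V)
    (f : hom (X ⊗ A) B) : ev A B ∘ (curry f ⊠ idm A) = f.
Proof.
unfold curry.
now destruct (constructive_indefinite_description _ _) as [g [gE gU]].
Qed.

Lemma curry_unique (V : symmetric_monoidal_closed_category) (A B X : V)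
    (f : hom (X ⊗ A) B) (g : hom X (ihom A B)) :
  ev A B ∘ (g ⊠ idm A) = f -> curry f = g.
Proof.
intro gE; unfold curry.
destruct (constructive_indefinite_description _ _) as [h [hE hU]]; simpl.
now apply hU.
Qed.

Lemma curry_comp (V : symmetric_monoidal_closed_category) (A B X Y : V)
    (f : hom (Y ⊗ A) B) (g : hom X Y) :
  curry (f ∘ (g ⊠ idm A)) = curry f ∘ g.
Proof.
apply curry_unique.
now rewrite tensor_comp_idl, comp_assoc, curryP.
Qed.

(** Currying turns cocones on the [e j ⊠ idm A] with apex [X] into cocones on the [e j] with apex
    [ihom A X], and likewise for mediating morphisms. *)
Lemma wide_pushout_tensor_idr (V : symmetric_monoidal_closed_category)
    (J : Type) (D : V) (Dj : J -> V) (e : forall j, hom D (Dj j)) (P : V)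
    (d : hom D P) (ebar : forall j, hom (Dj j) P) (A : V) :
  is_wide_pushout e d ebar ->
  is_wide_pushout (fun j => e j ⊠ idm A) (d ⊠ idm A)
    (fun j => ebar j ⊠ idm A).
Proof.
intros [comm univ]; split.
- now intro j; rewrite <- tensor_comp_idl, comm.
- intros X u v vu.
  destruct (univ (ihom A X) (curry u) (fun j => curry (v j)))
    as [t [[td te] tU]].
  { now intro j; rewrite <- curry_comp, vu. }
  exists (ev A X ∘ (t ⊠ idm A)); split; [split|].
  + now rewrite <- comp_assoc, <- tensor_comp_idl, td, curryP.
  + now intro j; rewrite <- comp_assoc, <- tensor_comp_idl, te, curryP.
  + intros s [sd se].
    rewrite (tU (curry s)); [apply curryP|split].
    * now rewrite <- curry_comp, sd.
    * now intro j; rewrite <- curry_comp, se.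
Qed.

(** Conjugation with the symmetry reduces this to tensoring on the other side. *)
Lemma wide_pushout_tensor_idl (V : symmetric_monoidal_closed_category)
    (J : Type) (D : V) (Dj : J -> V) (e : forall j, hom D (Dj j)) (P : V)
    (d : hom D P) (ebar : forall j, hom (Dj j) P) (A : V) :
  is_wide_pushout e d ebar ->
  is_wide_pushout (fun j => idm A ⊠ e j) (idm A ⊠ d)
    (fun j => idm A ⊠ ebar j).
Proof.
intro po; split.
- now destruct po as [comm _]; intro j; rewrite <- tensor_comp_idr, comm.
- intros X u v vu.
  destruct (wide_pushout_tensor_idr A po) as [_ univ].
  destruct (univ X (u ∘ sym D A) (fun j => v j ∘ sym (Dj j) A))
    as [t [[td te] tU]].
  { now intro j; rewrite <- comp_assoc, sym_natural, comp_assoc, vu. }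
  exists (t ∘ sym A P); split; [split|].
  + now rewrite <- comp_assoc, sym_natural, comp_assoc, td, <- comp_assoc,
      sym_invol, comp_idr.
  + now intro j; rewrite <- comp_assoc, sym_natural, comp_assoc, te,
      <- comp_assoc, sym_invol, comp_idr.
  + intros s [sd se].
    rewrite (tU (s ∘ sym P A)).
    { now rewrite <- comp_assoc, sym_invol, comp_idr. }
    split.
    * now rewrite <- comp_assoc, sym_natural, comp_assoc, sd.
    * now intro j; rewrite <- comp_assoc, sym_natural, comp_assoc, se.
Qed.

(** * The diagonal component, and wide pushouts of tensor squares *)

Lemma wide_pushout_diagonal_iso (C : category) (J : Type) (D : C)
    (Dj : J -> C) (e : forall j, hom D (Dj j)) (P : C) (d : hom D P)
    (ebar : forall j, hom (Dj j) P) :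
  (J -> False) -> is_wide_pushout e d ebar -> is_iso d.
Proof.
intros J0 [_ univ].
(* Without legs every morphism out of [D] is a cocone; [idm D] yields a retraction of [d]. *)
destruct (univ D (idm D) (fun j => False_rect _ (J0 j))) as [t [[td _] _]].
{ intro j; destruct (J0 j). }
exists t; split; [exact td|].
destruct (univ P d ebar) as [s [_ sU]].
{ intro j; destruct (J0 j). }
(* Both [d ∘ t] and [idm P] mediate from the cocone [d] to itself, hence they agree. *)
rewrite <- (sU (d ∘ t)), <- (sU (idm P)); [reflexivity| |]; split.
- apply comp_idl.
- intro j; destruct (J0 j).
- now rewrite <- comp_assoc, td, comp_idr.
- intro j; destruct (J0 j).
Qed.

Lemma wide_pushout_diagonal_in (V : monoidal_category) (E : morphism_class V)
    (J : Type) (D : V) (Dj : J -> V) (e : forall j, hom D (Dj j)) (P : V)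
    (d : hom D P) (ebar : forall j, hom (Dj j) P) :
  contains_isos E -> closed_under_composition E ->
  closed_under_wide_pushouts E ->
  (forall j, E _ _ (e j)) -> is_wide_pushout e d ebar -> E _ _ d.
Proof.
intros E_iso E_comp E_wide e_E po.
destruct (classic (inhabited J)) as [[j]|J0].
- rewrite <- (proj1 po j).
  apply E_comp; [exact (E_wide _ _ _ _ _ _ _ e_E po j)|apply e_E].
- apply E_iso, (wide_pushout_diagonal_iso (fun j => J0 (inhabits j)) po).
Qed.

Lemma wide_pushout_tensor_square (V : symmetric_monoidal_closed_category)
    (E : morphism_class V) (J : Type) (D : V) (Dj : J -> V)
    (e : forall j, hom D (Dj j)) (P : V) (d : hom D P)
    (ebar : forall j, hom (Dj j) P) :
  consists_of_epis E -> contains_isos E -> stable_wrt E ->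
  closed_under_tensor E -> (forall j, E _ _ (e j)) -> E _ _ d ->
  is_wide_pushout e d ebar ->
  is_wide_pushout (fun j => e j ⊠ e j) (d ⊠ d) (fun j => ebar j ⊠ ebar j).
Proof.
intros E_epi E_iso E_stable E_tensor e_E d_E po.
assert (idm_E : forall A : V, E _ _ (idm A)).
{ intro A; apply E_iso; exists (idm A); split; apply comp_idl. }
pose proof (proj1 po) as comm.
split.
{ now intro j; rewrite <- tensor_comp, comm. }
intros X u v vu.
destruct (wide_pushout_tensor_idr D po) as [_ univr].
destruct (univr X u (fun j => v j ∘ (idm (Dj j) ⊠ e j)))
  as [s [[sd se] _]].
{ now intro j; rewrite <- comp_assoc, <- tensor_split_idl. }
destruct (wide_pushout_tensor_idl D po) as [_ univl].
destruct (univl X u (fun j => v j ∘ (e j ⊠ idm (Dj j))))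
  as [r [[rd _] _]].
{ now intro j; rewrite <- comp_assoc, <- tensor_split_idr. }
destruct (E_stable _ _ _ _ d d d_E d_E) as [_ glue].
destruct (glue X s r) as [t [[ts tr] _]].
{ now rewrite sd, rd. }
assert (td : t ∘ (d ⊠ d) = u).
{ now rewrite tensor_split_idl, comp_assoc, ts. }
exists t; split; [split|].
- exact td.
- intro j.
  (* After this precomposition the left side is [t ∘ (ebar j ⊠ d)], which factors through
     [t ∘ (idm P ⊠ d) = s]. *)
  apply (E_epi _ _ (idm (Dj j) ⊠ e j)).
  { now apply E_tensor. }
  now rewrite <- comp_assoc, <- tensor_comp, comp_idr, comm, tensor_split_idl,
    comp_assoc, ts, se.
- intros t' [t'd _].
  apply (E_epi _ _ (d ⊠ d)); [now apply E_tensor|].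
  now rewrite t'd.
Qed.

(** * Monoid structures and morphisms along epimorphisms *)

Lemma monoid_structure_along_epi (V : monoidal_category) (M N : V)
    (S : monoid_structure M) (d : hom M N) (m : hom (N ⊗ N) N) :
  is_epi ((d ⊠ d) ⊠ d) -> is_epi (idm unit_obj ⊠ d) ->
  is_epi (d ⊠ idm unit_obj) ->
  m ∘ (d ⊠ d) = d ∘ mul S ->
  exists T : monoid_structure N, mul T = m /\ is_monoid_morphism S T d.
Proof.
intros epi3 epil epir md.
(* With [d ∘ one S] as unit, each law, precomposed with a suitable tensor product of [d] and
   identities, becomes [d] composed with the same law of [S], up to naturality. *)
assert (massoc : m ∘ (m ⊠ idm N) = m ∘ (idm N ⊠ m) ∘ assoc N N N).
{ apply epi3.
  rewrite <- !comp_assoc, assoc_natural, <- tensor_comp, md, comp_idl.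
  rewrite (comp_assoc (idm N ⊠ m)), <- tensor_comp, md, comp_idl.
  (* Writing the lone tensor factor [d] as [d ∘ idm] splits off [d ⊠ d], so that [md] applies a
     second time; the next line does this on the right side. *)
  rewrite <- (comp_idr d) at 2; rewrite tensor_comp, comp_assoc, md.
  rewrite <- (comp_idr d) at 2; rewrite tensor_comp, !comp_assoc, md.
  now rewrite <- !comp_assoc, mul_assoc, !comp_assoc. }
assert (monel : m ∘ ((d ∘ one S) ⊠ idm N) = lunit N).
{ apply epil.
  rewrite <- comp_assoc, <- tensor_comp, comp_idl, comp_idr, lunit_natural.
  rewrite <- mul_onel with (m := S), comp_assoc, <- md, <- comp_assoc.
  now rewrite <- tensor_comp, comp_idr. }
assert (moner : m ∘ (idm N ⊠ (d ∘ one S)) = runit N).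
{ apply epir.
  rewrite <- comp_assoc, <- tensor_comp, comp_idl, comp_idr, runit_natural.
  rewrite <- mul_oner with (m := S), comp_assoc, <- md, <- comp_assoc.
  now rewrite <- tensor_comp, comp_idr. }
now exists (MonoidStructure massoc monel moner).
Qed.

(** Multiplicativity of [g] is tested on [f ⊠ f]; units need no cancellation, since [one T] is the
    image of [one S]. This lifts mediating morphisms to monoid morphisms. *)
Lemma is_monoid_morphism_of_comp (V : monoidal_category) (M N P : V)
    (S : monoid_structure M) (T : monoid_structure N) (U : monoid_structure P)
    (f : hom M N) (g : hom N P) :
  is_epi (f ⊠ f) -> is_monoid_morphism S T f ->
  is_monoid_morphism S U (g ∘ f) -> is_monoid_morphism T U g.
Proof.
intros epi [fm f1] [gfm gf1]; split.
- apply epi.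
  now rewrite <- !comp_assoc, <- fm, <- tensor_comp, <- gfm, comp_assoc.
- now rewrite <- f1, comp_assoc.
Qed.

Lemma monoid_structure_epi_unique (V : monoidal_category) (M N : V)
    (S : monoid_structure M) (T T' : monoid_structure N) (f : hom M N) :
  is_epi (f ⊠ f) -> is_monoid_morphism S T f -> is_monoid_morphism S T' f ->
  T = T'.
Proof.
intros epi [fm f1] [fm' f1']; apply monoid_structure_eq.
- now apply epi; rewrite <- fm, <- fm'.
- now rewrite <- f1, <- f1'.
Qed.

Theorem theorem3p8 (V : symmetric_monoidal_closed_category)
    (E : morphism_class V)
    (E_epi : consists_of_epis E)
    (E_iso : contains_isos E)
    (E_comp : closed_under_composition E)
    (E_stable : stable_wrt E)
    (E_wide : closed_under_wide_pushouts E)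
    (E_tensor : closed_under_tensor E)
    (J : Type) (D : Mon V) (Dj : J -> Mon V)
    (e : forall j : J, @hom (Mon V) D (Dj j))
    (e_E : forall j : J, E _ _ (underlying (e j)))
    (Dbar : V) (d : hom (carrier D) Dbar)
    (ebar : forall j : J, hom (carrier (Dj j)) Dbar)
    (ebar_po : is_wide_pushout (fun j => underlying (e j)) d ebar) :
  exists S : monoid_structure Dbar,
    unique (fun T : monoid_structure Dbar =>
      is_monoid_morphism (structure D) T d /\
      forall j : J, is_monoid_morphism (structure (Dj j)) T (ebar j)) S /\
    exists (d_mor : is_monoid_morphism (structure D) S d)
      (ebar_mor :
         forall j : J, is_monoid_morphism (structure (Dj j)) S (ebar j)),
      @is_wide_pushout (Mon V) J D Dj e (Monoid S)
        (@MonoidMorphism V D (Monoid S) d d_mor)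
        (fun j => @MonoidMorphism V (Dj j) (Monoid S) (ebar j) (ebar_mor j)).
Proof.
pose proof (wide_pushout_diagonal_in E_iso E_comp E_wide e_E ebar_po) as d_E.
assert (idm_E : E _ _ (idm (unit_obj : V))).
{ apply E_iso; exists (idm unit_obj); split; apply comp_idl. }
assert (epi2 : is_epi (d ⊠ d)) by (apply E_epi, E_tensor; exact d_E).
destruct (wide_pushout_tensor_square E_epi E_iso E_stable E_tensor e_E d_E
  ebar_po) as [_ univ2].
pose proof (proj1 ebar_po) as comm.
destruct (univ2 Dbar (d ∘ mul (structure D))
    (fun j => ebar j ∘ mul (structure (Dj j)))) as [m [[md me] _]].
{ intro j.
  now rewrite <- comp_assoc, <- (proj1 (underlyingP (e j))), comp_assoc,
    comm. }
destruct (monoid_structure_along_epi (S := structure D) (d := d) (m := m))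
  as [S [Sm d_mor]]; [apply E_epi; auto..|exact md|].
assert (ebar_mor :
  forall j, is_monoid_morphism (structure (Dj j)) S (ebar j)).
{ intro j; split.
  - now rewrite Sm, me.
  - now rewrite <- (proj2 (underlyingP (e j))), comp_assoc, comm,
      (proj2 d_mor). }
exists S; split.
{ split; [now split|].
  (* That [d] is a monoid morphism already determines the structure. *)
  now intros T [Td _]; apply (monoid_structure_epi_unique epi2 d_mor Td). }
exists d_mor, ebar_mor; split.
- now intro j; apply monoid_morphism_eq; simpl; apply comm.
- intros X u v vu.
  destruct (proj2 ebar_po X (underlying u) (fun j => underlying (v j)))
    as [t [[td te] tU]].
  { now intro j; rewrite <- (vu j). }
  assert (t_mor : is_monoid_morphism S (structure X) t).
  (* Precomposed with [d], the mediating morphism [t] becomes the monoid morphism [u]. *)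
  { apply (is_monoid_morphism_of_comp epi2 d_mor).
    rewrite td; apply underlyingP. }
  exists (@MonoidMorphism V (Monoid S) X t t_mor); split; [split|].
  + now apply monoid_morphism_eq.
  + now intro j; apply monoid_morphism_eq; simpl.
  + intros s [sd se]; apply monoid_morphism_eq; simpl.
    apply tU; split.
    * now rewrite <- sd.
    * now intro j; rewrite <- (se j).
Qed.
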